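(* Let $v=x_1\ldots x_{n-1}$ ($n\ge1$) be a word over $\{0,1\}$. Then the group $\mathfrak{K}(v)$ is not (regular) branch; that is, there is no subgroup $H$ of finite index in $\mathfrak{K}(v)$ such that $\mathfrak{K}(v)$ is regular weakly branch on $H$.
   Context: Automorphisms of the binary rooted tree $\{0,1\}^*$ act on the right. $\langle\langle g_0,g_1\rangle\rangle$ denotes the automorphism $0u\mapsto0u^{g_0}$, $1u\mapsto1u^{g_1}$; $\sigma$ exchanges $0$ and $1$ in the first letter; $\langle\langle g_0,g_1\rangle\rangle\sigma$ means first apply $\langle\langle g_0,g_1\rangle\rangle$, then $\sigma$. For $v=x_1\ldots x_{n-1}$, $\mathfrak{K}(v)$ is the subgroup of $\mathrm{Aut}(\{0,1\}^* )$ generated by $a_1,\dots,a_n$ defined recursively by $a_1=\langle\langle1,a_n\rangle\rangle\sigma$ and, for $1\le i<n$, $a_{i+1}=\langle\langle a_i,1\rangle\rangle$ if $x_i=0$, $a_{i+1}=\langle\langle1,a_i\rangle\rangle$ if $x_i=1$. A group $G\le\mathrm{Aut}(\{0,1\}^* )$ is regular weakly branch on a subgroup $H\le G$ if $H$ is non-trivial and contains the geometric direct product $H\times H=\{\langle\langle h_0,h_1\rangle\rangle:h_0,h_1\in H\}$. It is regular branch on $H$ if moreover $H$ has finite index in $G$. *)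

(* Defs.v *)
From HB Require Import structures.
From mathcomp Require Import all_boot.
From mathcomp Require Import all_classical.

Set Implicit Arguments.
Unset Strict Implicit.
Unset Printing Implicit Defensive.

Local Open Scope classical_set_scope.
Local Open Scope group_scope.

(* The vertices of the binary rooted tree are the words of type [seq bool],
   the letter 0 being [false] and the letter 1 being [true]; the root is the
   empty word, and the edges join [u] and [rcons u x]. *)
Definition tree_edge (u w : seq bool) : Prop :=
  exists x : bool, w = rcons u x \/ u = rcons w x.

Record tree_aut : Type := TreeAut {
  tree_act :> seq bool -> seq bool;
  tree_act_bij : bijective tree_act;
  tree_act_root : tree_act [::] = [::];
  tree_act_edge : forall u w,
    tree_edge (tree_act u) (tree_act w) <-> tree_edge u w }.

Lemma tree_autP (g h : tree_aut) : g =1 h -> g = h.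
Proof.
case: g h => [g gb gr ge] [h hb hr he] /= /funext egh.
by subst h; congr TreeAut; exact: Prop_irrelevance.
Qed.

HB.instance Definition _ := gen_eqMixin tree_aut.
HB.instance Definition _ := gen_choiceMixin tree_aut.

Lemma tree_aut1_edge u w : tree_edge (id u) (id w) <-> tree_edge u w.
Proof. by []. Qed.

Definition tree_aut1 : tree_aut :=
  TreeAut (Bijective (fun=> erefl) (fun=> erefl)) erefl tree_aut1_edge.

Section Mul.
Variables g h : tree_aut.

Lemma tree_mul_root : (h \o g) [::] = [::].
Proof. by rewrite /= !tree_act_root. Qed.

Lemma tree_mul_edge u w : tree_edge ((h \o g) u) ((h \o g) w) <-> tree_edge u w.
Proof. exact: (iff_trans (tree_act_edge h _ _) (tree_act_edge g _ _)). Qed.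

(* Automorphisms act on the right: [g * h] is [g] followed by [h]. *)
Definition tree_mul : tree_aut :=
  TreeAut (bij_comp (tree_act_bij h) (tree_act_bij g))
    tree_mul_root tree_mul_edge.

End Mul.

Section Inv.
Variable g : tree_aut.

Lemma tree_act_inv_ex : exists k, cancel g k /\ cancel k g.
Proof. by case: (tree_act_bij g) => k gK kK; exists k. Qed.

Definition tree_act_inv : seq bool -> seq bool := sval (cid tree_act_inv_ex).

Lemma tree_actK : cancel g tree_act_inv.
Proof. exact: (svalP (cid tree_act_inv_ex)).1. Qed.

Lemma tree_actVK : cancel tree_act_inv g.
Proof. exact: (svalP (cid tree_act_inv_ex)).2. Qed.

Lemma tree_inv_root : tree_act_inv [::] = [::].
Proof. by rewrite -{1}(tree_act_root g) tree_actK. Qed.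

Lemma tree_inv_edge u w :
  tree_edge (tree_act_inv u) (tree_act_inv w) <-> tree_edge u w.
Proof.
by apply: (iff_trans (iff_sym (tree_act_edge g _ _))); rewrite !tree_actVK.
Qed.

Definition tree_inv : tree_aut :=
  TreeAut (Bijective tree_actVK tree_actK) tree_inv_root tree_inv_edge.

End Inv.

Fact tree_mulA : associative tree_mul.
Proof. by move=> f g h; apply: tree_autP. Qed.

Fact tree_mul1 : left_id tree_aut1 tree_mul.
Proof. by move=> g; apply: tree_autP. Qed.

Fact tree_mulr1 : right_id tree_aut1 tree_mul.
Proof. by move=> g; apply: tree_autP. Qed.

Fact tree_mulV : left_inverse tree_aut1 tree_inv tree_mul.
Proof. by move=> g; apply: tree_autP => u /=; exact: tree_actVK. Qed.

Fact tree_mulrV : right_inverse tree_aut1 tree_inv tree_mul.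
Proof. by move=> g; apply: tree_autP => u /=; exact: tree_actK. Qed.

HB.instance Definition _ := isGroup.Build tree_aut
  tree_mulA tree_mul1 tree_mulr1 tree_mulV tree_mulrV.

Lemma tree_edge_cons x y u w :
  tree_edge (x :: u) (y :: w) <-> x = y /\ tree_edge u w.
Proof.
split=> [[z []] /= [-> ->]|[-> [z [->|->]]]]; last 2 first.
- by exists z; left.
- by exists z; right.
- by split=> //; exists z; left.
- by split=> //; exists z; right.
Qed.

Lemma tree_edge_nil_cons y w : tree_edge [::] (y :: w) <-> w = [::].
Proof.
split=> [[z [[_ ->]//|/esym/eqP]]|->]; first by rewrite -size_eq0 size_rcons.
by exists y; left.
Qed.

Lemma tree_edge_sym u w : tree_edge u w <-> tree_edge w u.
Proof. by split=> -[z [h|h]]; exists z; [right|left|right|left]. Qed.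

(* [tree_node s g] sends [x :: u] to [x' :: g x u], where [x'] is [x] if
   [s = false] and the other letter if [s = true]. *)
Section Node.
Variables (s : bool) (g : bool -> tree_aut).

Definition node_act (w : seq bool) : seq bool :=
  if w is x :: u then (s (+) x) :: g x u else [::].

Lemma node_act_bij : bijective node_act.
Proof.
exists (fun w => if w is x :: u then (s (+) x) :: (g (s (+) x))^-1 u else [::]).
  by case=> //= x u; rewrite addKb tree_actK.
by case=> //= x u; rewrite addKb tree_actVK.
Qed.

Lemma node_act_edge u w : tree_edge (node_act u) (node_act w) <-> tree_edge u w.
Proof.
have nil_eq x t : g x t = [::] <-> t = [::].
  split=> [e|->]; last exact: tree_act_root.
  by apply: (bij_inj (tree_act_bij (g x))); rewrite e tree_act_root.
case: u w => [|x u] [|y w] //=.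
- by rewrite !tree_edge_nil_cons.
- by rewrite tree_edge_sym [X in _ <-> X]tree_edge_sym !tree_edge_nil_cons.
rewrite !tree_edge_cons; split=> -[].
  by move=> /(can_inj (addKb s)) <- /tree_act_edge.
by move=> <- ?; split=> //; apply/tree_act_edge.
Qed.

Definition tree_node : tree_aut := TreeAut node_act_bij erefl node_act_edge.

End Node.

(* <<g0, g1>> *)
Definition tree_pair (g0 g1 : tree_aut) : tree_aut :=
  tree_node false (fun x => if x then g1 else g0).

Definition tree_swap : tree_aut := tree_node true (fun=> 1).

Lemma tree_pairE g0 g1 x u :
  tree_pair g0 g1 (x :: u) = x :: (if x then g1 u else g0 u).
Proof. by case: x. Qed.

Lemma tree_swapE x u : tree_swap (x :: u) = ~~ x :: u.
Proof. by []. Qed.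

Lemma tree_mulE (g h : tree_aut) u : (g * h) u = h (g u).
Proof. by []. Qed.

(* The recursion defining the generators determines their action on words
   by recursion on the word.  Indices are shifted by one: [gen_act v i] is the
   action of a_(i+1) for 0 <= i <= size v, where n = (size v).+1, and the
   letter x_(i+1) of v is [nth false v i]. *)
Fixpoint gen_act (v : seq bool) (i : nat) (w : seq bool) : seq bool :=
  if w is x :: u then
    if i is j.+1 then x :: (if x == nth false v j then gen_act v j u else u)
    else ~~ x :: (if x then gen_act v (size v) u else u)
  else [::].

Section Gen.
Variable v : seq bool.

Fixpoint gen_act_inv (i : nat) (w : seq bool) : seq bool :=
  if w is x :: u then
    if i is j.+1 then x :: (if x == nth false v j then gen_act_inv j u else u)
    else ~~ x :: (if x then u else gen_act_inv (size v) u)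
  else [::].

Lemma gen_act_bij i : bijective (gen_act v i).
Proof.
exists (gen_act_inv i) => w; elim: w i => //= x u IH [|i] /=.
- by rewrite negbK; case: x => //=; rewrite IH.
- by case: (x == _) => //; rewrite IH.
- by rewrite negbK; case: x => //=; rewrite IH.
- by case: (x == _) => //; rewrite IH.
Qed.

Lemma gen_act_edge i u w :
  tree_edge (gen_act v i u) (gen_act v i w) <-> tree_edge u w.
Proof.
have nil_eq k t : gen_act v k t = [::] <-> t = [::].
  by split=> [|->//]; case: t k => [|? ?] [|?].
elim: u w i => [|x u IH] [|y w] [|i] //=.
- rewrite !tree_edge_nil_cons; case: y => //; exact: nil_eq.
- by rewrite !tree_edge_nil_cons; case: (y == _).
- rewrite tree_edge_sym [X in _ <-> X]tree_edge_sym !tree_edge_nil_cons.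
  by case: x IH => // _; exact: nil_eq.
- rewrite tree_edge_sym [X in _ <-> X]tree_edge_sym !tree_edge_nil_cons.
  by case: (x == _).
- rewrite !tree_edge_cons; split=> -[].
    by move=> /negb_inj <-; case: x => // /IH.
  by move=> <- ?; split=> //; case: x => //; apply/IH.
- rewrite !tree_edge_cons; split=> -[].
    by move=> <-; case: (x == _) => // /IH.
  by move=> <- ?; split=> //; case: (x == _) => //; apply/IH.
Qed.

Lemma gen_act_root i : gen_act v i [::] = [::].
Proof. by []. Qed.

Definition kgen (i : nat) : tree_aut :=
  TreeAut (gen_act_bij i) (gen_act_root i) (gen_act_edge i).

Lemma kgen0E : kgen 0 = tree_pair 1 (kgen (size v)) * tree_swap.
Proof. by apply: tree_autP => -[|[] u]. Qed.

Lemma kgenSE i :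
  kgen i.+1 = if nth false v i then tree_pair 1 (kgen i)
              else tree_pair (kgen i) 1.
Proof.
by apply: tree_autP => -[|[] u] /=; case: (nth false v i).
Qed.

End Gen.

Definition is_subgroup (gT : groupType) (H : set gT) : Prop :=
  group_closed (mem H).

(* The set of right cosets of H with representatives in G is finite. *)
Definition finite_index (gT : groupType) (G H : set gT) : Prop :=
  finite_set [set [set h * g | h in H] | g in G].

Definition Kgroup (v : seq bool) : set tree_aut :=
  smallest (@is_subgroup tree_aut) [set kgen v i | i in `I_(size v).+1].

Definition geom_prod (H0 H1 : set tree_aut) : set tree_aut :=
  [set tree_pair h.1 h.2 | h in H0 `*` H1].

Definition regular_weakly_branch_on (G H : set tree_aut) : Prop :=
  [/\ is_subgroup H, H `<=` G, H <> [set 1] & geom_prod H H `<=` H].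

Definition regular_branch_on (G H : set tree_aut) : Prop :=
  regular_weakly_branch_on G H /\ finite_index G H.

(* Main.v *)
Require Import Defs.
From mathcomp Require Import all_boot all_classical.
From mathcomp Require Import ssralg ssrnum ssrint.
From mathcomp Require Import zify.

(** Write n for the number of generators.  Counting the letters a_i of a word
    with sign gives the exponent sums e_1, ..., e_n.  A word w that fixes the
    two vertices of the first level decomposes as <<w_0, w_1>>, where w_0 and
    w_1 are words in the same generators.  Since a_(i+1) contributes a_i to exactly one
    of the two coordinates, e_(i+1)(w) = e_i(w_0) + e_i(w_1); and since w passes
    alternately through the two letters, the contributions of a_1 are shared
    equally: 2 e_n(w_0) = e_1(w) = 2 e_n(w_1).

    The exponent sums of a word representing 1 vanish
    ([expo_trivial_word]), because the lengths of w_0 and w_1 add up to the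
    length of w, which allows an induction; so e_n is defined on the group
    itself.
    Consequently <<g, 1>> can lie in the group only if e_n(g) = e_n(1) = 0
    ([no_power_section]).  But a subgroup H of finite index contains some
    a_n^k with k > 0, and if H contains H x H then it contains <<a_n^k, 1>>,
    although e_n(a_n^k) = k. *)

Set Implicit Arguments.
Unset Strict Implicit.
Unset Printing Implicit Defensive.

Local Open Scope group_scope.

(** * Subgroups of finite index *)

(** There are fewer cosets than exponents, so a ^+ i and a ^+ j lie in the same
    coset of H for some i < j; then a ^+ (j - i) lies in H. *)
Lemma finite_index_power (gT : groupType) (G H : set gT) (a : gT) :
    is_subgroup H -> finite_index G H -> (forall k, G (a ^+ k)) ->
  exists2 k, 0 < k & H (a ^+ k).
Proof.
move=> [] /set_mem H1 HV finGH Ga.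
pose coset k := ([set h * a ^+ k | h in H])%classic.
have [[i [j [ltij eq_ij]]]|no_coll] :=
    pselect (exists i j, i < j /\ coset i = coset j).
  exists (j - i); first by rewrite subn_gt0.
  have [h Hh hij] : coset i (a ^+ j).
    by rewrite eq_ij; exists 1 => //; rewrite mul1g.
  suff -> : a ^+ (j - i) = h by [].
  by apply: (mulIg (a ^+ i)); rewrite -expgnDr subnK // ltnW.
have coset_inj : injective coset.
  move=> i j eq_ij; case: (ltngtP i j) => // lt; case: no_coll.
    by exists i, j.
  by exists j, i.
case: infinite_nat.
have -> : [set: nat]%classic =
    (coset @^-1` [set [set h * g | h in H] | g in G])%classic.
  by apply/seteqP; split=> k //= _; exists (a ^+ k).
by apply: finite_preimage => // i j _ _; exact: coset_inj.
Qed.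

(** * Words in the generators *)

(** The letter [(b, i)] stands for a_(i+1) if [b = false] and for its inverse
    if [b = true]. *)
Definition letter : Type := bool * nat.

Section Words.
Variable v : seq bool.

Definition letter_eval (l : letter) : tree_aut :=
  if l.1 then (kgen v l.2)^-1 else kgen v l.2.

Definition word_eval (w : seq letter) : tree_aut :=
  \prod_(l <- w) letter_eval l.

Definition valid_word (w : seq letter) : bool :=
  all (fun l : letter => l.2 <= size v) w.

Definition word_inv (w : seq letter) : seq letter :=
  rev [seq (~~ l.1, l.2) | l <- w].

Lemma word_eval_cons l w : word_eval (l :: w) = letter_eval l * word_eval w.
Proof. exact: big_cons. Qed.

Lemma word_eval_cat w1 w2 : word_eval (w1 ++ w2) = word_eval w1 * word_eval w2.
Proof. exact: big_cat. Qed.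

Lemma word_eval_inv w : word_eval (word_inv w) = (word_eval w)^-1.
Proof.
rewrite /word_inv; elim: w => [|[b i] w IH] /=.
  by rewrite /word_eval big_nil invg1.
rewrite rev_cons -cats1 word_eval_cat IH word_eval_cons invgM; congr (_ * _).
rewrite word_eval_cons /word_eval big_nil mulg1 /letter_eval.
by case: b => //=; rewrite invgK.
Qed.

Lemma word_eval_nseq b i k :
  word_eval (nseq k (b, i)) = letter_eval (b, i) ^+ k.
Proof.
elim: k => [|k IH]; first by rewrite /word_eval big_nil expg0.
by rewrite /= word_eval_cons IH expgS.
Qed.

Lemma Kgroup_word g :
  Kgroup v g -> exists2 w, valid_word w & g = word_eval w.
Proof.
pose P := [set word_eval w | w in [set w | valid_word w]]%classic.
suff /[apply] [[w vw <-]] : (Kgroup v `<=` P)%classic by exists w.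
apply: smallest_sub.
  split; first by apply/mem_set; exists [::] => //; rewrite /word_eval big_nil.
  move=> _ _ /set_mem[w1 vw1 <-] /set_mem[w2 vw2 <-]; apply/mem_set.
  exists (w1 ++ word_inv w2); last by rewrite word_eval_cat word_eval_inv.
  by rewrite /= /valid_word all_cat all_rev all_map; apply/andP.
move=> _ [i lti <-]; exists [:: (false, i)].
  by rewrite /= /valid_word /= andbT.
by rewrite word_eval_cons /word_eval big_nil mulg1.
Qed.

Lemma Kgroup_gen_power i k : i <= size v -> Kgroup v (kgen v i ^+ k).
Proof.
move=> le_i A [] subA genA.
have Ai : A (kgen v i) by apply: genA; exists i.
elim: k => [|k IH]; first by rewrite expg0; case: subA => /set_mem.
rewrite expgS; apply/set_mem.
by apply: (group_closedM subA); exact/mem_set.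
Qed.

(** * Sections of words *)

Definition letter_swaps (l : letter) : bool := l.2 == 0.

Definition word_swaps (w : seq letter) : bool :=
  foldr (fun l b => letter_swaps l (+) b) false w.

(** The section of a_1 is nontrivial at the letter 1 only; that of its inverse
    at the letter 0 only. *)
Definition letter_section (l : letter) (x : bool) : seq letter :=
  if l.2 is j.+1 then if x == nth false v j then [:: (l.1, j)] else [::]
  else if x (+) l.1 then [:: (l.1, size v)] else [::].

Fixpoint word_section (w : seq letter) (x : bool) : seq letter :=
  if w is l :: w' then
    letter_section l x ++ word_section w' (letter_swaps l (+) x)
  else [::].

Lemma letter_eval_cons l x u :
  letter_eval l (x :: u)
    = (letter_swaps l (+) x) :: word_eval (letter_section l x) u.
Proof.
have word1 l' : word_eval [:: l'] = letter_eval l'.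
  by rewrite word_eval_cons /word_eval big_nil mulg1.
have word0 : word_eval [::] = 1 by rewrite /word_eval big_nil.
have pos i y t : kgen v i (y :: t)
    = (letter_swaps (false, i) (+) y)
        :: word_eval (letter_section (false, i) y) t.
  case: i => [|j] /=; rewrite /letter_section /= ?addbF.
    by case: y; rewrite ?word1 ?word0.
  by case: ifP; rewrite ?word1 ?word0.
case: l => [[] i]; last exact: pos.
(* The right-hand side is mapped to [x :: u] by the generator itself. *)
rewrite {1}/letter_eval /=.
apply: (bij_inj (tree_act_bij (kgen v i))).
have genVK j t : letter_eval (false, j) (letter_eval (true, j) t) = t.
  exact: tree_actVK.
rewrite [LHS](genVK i) pos; case: i => [|j] /=; rewrite /letter_section /=.
  by case: x; rewrite /= ?word1 ?word0 ?genVK.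
by case: ifP; rewrite ?word1 ?word0 ?genVK.
Qed.

Lemma word_eval_section w x u :
  word_eval w (x :: u) = (word_swaps w (+) x) :: word_eval (word_section w x) u.
Proof.
elim: w x u => [|l w IH] x u; first by rewrite /word_eval big_nil.
rewrite word_eval_cons tree_mulE letter_eval_cons IH /= word_eval_cat tree_mulE.
by rewrite addbA (addbC (word_swaps w)).
Qed.

Lemma word_eval_pair w g0 g1 : word_eval w = tree_pair g0 g1 ->
  [/\ word_swaps w = false, word_eval (word_section w false) = g0
    & word_eval (word_section w true) = g1].
Proof.
move=> eq_w.
have eq_cons x u :
    (word_swaps w (+) x) :: word_eval (word_section w x) u
      = x :: (if x then g1 u else g0 u).
  by rewrite -word_eval_section eq_w tree_pairE.
split; first by case: (eq_cons false [::]); case: (word_swaps w).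
  by apply: tree_autP => u; case: (eq_cons false u).
by apply: tree_autP => u; case: (eq_cons true u).
Qed.

Lemma word_eval_trivial w : word_eval w = 1 ->
  word_swaps w = false /\ forall x, word_eval (word_section w x) = 1.
Proof.
move=> w1; have [|sw ev0 ev1] := @word_eval_pair w 1 1; last by split=> // -[].
by rewrite w1; apply: tree_autP => -[|[] u].
Qed.

Lemma valid_word_section w x : valid_word w -> valid_word (word_section w x).
Proof.
elim: w x => [|[b i] w IH] x //= /andP[vi vw].
rewrite /valid_word all_cat; apply/andP; split; last exact: IH.
case: i vi => [|j] vi; rewrite /letter_section /=; case: ifP => //= _.
  by rewrite leqnn.
by rewrite andbT ltnW.
Qed.

(** Each letter has a nontrivial section at exactly one of the two letters of
    the tree alphabet. *)
Lemma size_word_section w :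
  size (word_section w false) + size (word_section w true) = size w.
Proof.
have size_letter l :
    size (letter_section l false) + size (letter_section l true) = 1%N.
  by case: l => [[] [|j]]; rewrite /letter_section //=; case: (nth _ _ _).
elim: w => //= l w IH; rewrite !size_cat addnACA size_letter -IH.
by case: (letter_swaps l); rewrite //= [X in _ + X]addnC.
Qed.

End Words.

(** * Exponent sums *)

Section Exponents.
Local Open Scope ring_scope.

Definition letter_expo (i : nat) (l : letter) : int :=
  if l.2 == i then (if l.1 then -1 else 1) else 0.

Definition expo (i : nat) (w : seq letter) : int :=
  \sum_(l <- w) letter_expo i l.

Lemma expo_nil i : expo i [::] = 0.
Proof. exact: big_nil. Qed.

Lemma expo_cons i l w : expo i (l :: w) = letter_expo i l + expo i w.
Proof. exact: big_cons. Qed.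

Lemma expo_cat i w1 w2 : expo i (w1 ++ w2) = expo i w1 + expo i w2.
Proof. exact: big_cat. Qed.

Lemma expo_nseq_inv i k : expo i (nseq k (true, i)) = - k%:Z.
Proof.
elim: k => [|k IH]; first by rewrite expo_nil.
by rewrite /= expo_cons IH /letter_expo eqxx /=; lia.
Qed.

Variable v : seq bool.

Lemma expo_section_sum j w : (j < size v)%N ->
  expo j (word_section v w false) + expo j (word_section v w true)
    = expo j.+1 w.
Proof.
move=> ltj.
have expo_letter l :
    expo j (letter_section v l false) + expo j (letter_section v l true)
      = letter_expo j.+1 l.
  case: l => b [|i]; rewrite /letter_section /letter_expo /=.
    have : (size v == j) = false by apply/eqP; lia.
    by case: b; rewrite /= !expo_nil expo_cons expo_nil /letter_expo /= => ->.
  rewrite eqSS; case: (nth _ _ _);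
    by rewrite /= !expo_nil expo_cons expo_nil /letter_expo /=; lia.
elim: w => [|l w IH]; first by rewrite /= !expo_nil.
rewrite /= !expo_cat expo_cons -IH -expo_letter.
by case: (letter_swaps l) => /=; lia.
Qed.

(** A passage of a_1 through the letter 1 contributes 1 to the section and moves
    the letter to 0, a passage through 0 contributes nothing and moves it to 1;
    in both cases twice the contribution is 1 plus the decrease of the letter.
    For the inverse of a_1 it is -1 plus that decrease, and the decreases
    telescope along the word. *)
Lemma expo_section_last w (x : bool) : valid_word v w ->
  2 * expo (size v) (word_section v w x)
    = expo 0 w + (x : nat)%:Z - (word_swaps w (+) x : nat)%:Z.
Proof.
have expo_letter l y : (l.2 <= size v)%N ->
    2 * expo (size v) (letter_section v l y)
      = letter_expo 0 l + (y : nat)%:Z - (letter_swaps l (+) y : nat)%:Z.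
  case: l => b [|i] /= lei;
      rewrite /letter_section /letter_expo /letter_swaps /=.
    by case: b; case: y; rewrite /= ?expo_cons expo_nil /letter_expo /= ?eqxx.
  have Ei : (i == size v) = false by apply/eqP; lia.
  by case: ifP => _; rewrite ?expo_cons expo_nil /letter_expo /= ?Ei; lia.
elim: w x => [|l w IH] x /=; first by rewrite !expo_nil; lia.
case/andP=> vl vw; rewrite expo_cat expo_cons GRing.mulrDr expo_letter // IH //.
by rewrite addbA (addbC (word_swaps w)); lia.
Qed.

(** Induction on the length of the word, then on the index.  One of the two
    sections is shorter than the word, and e_1 is twice the sum e_n of that
    section; e_(i+1) is the sum of the e_i of both sections, which are not
    longer than the word. *)
Lemma expo_trivial_word i w : (i <= size v)%N -> valid_word v w ->
  word_eval v w = 1%g -> expo i w = 0.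
Proof.
elim: {w}(size w).+1 {-2}w (ltnSn (size w)) i => // m IHm w ltwm i.
elim: i w ltwm => [|i IHi] w ltwm lei vw w1.
  have [/size0nil -> | w_gt0] := posnP (size w); first exact: expo_nil.
  have sizeD := size_word_section v w.
  have [sw evx] := word_eval_trivial w1.
  have [x ltx] : exists x : bool, (size (word_section v w x) < m)%N.
    have [|] := ltnP (size (word_section v w false)) m; first by exists false.
    by exists true; lia.
  have := expo_section_last x vw.
  rewrite IHm ?valid_word_section // sw /=; lia.
have sizeD := size_word_section v w.
have [_ evx] := word_eval_trivial w1.
rewrite -expo_section_sum // !IHi ?valid_word_section //; lia.
Qed.

End Exponents.

(** In a word w for <<a_n^k, 1>> the two sections have the same sum e_n; it is k
    for the first and 0 for the second. *)
Lemma no_power_section (v : seq bool) (k : nat) :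
  Kgroup v (tree_pair (kgen v (size v) ^+ k) 1) -> k = 0.
Proof.
move=> /Kgroup_word[w vw /esym /word_eval_pair[sw ev0 ev1]].
have e0 := expo_section_last false vw.
have e1 := expo_section_last true vw.
have triv1 := expo_trivial_word (leqnn _) (valid_word_section true vw) ev1.
(* Cancelling a_n^k turns the first section into a trivial word too. *)
have : expo (size v) (word_section v w false ++ nseq k (true, size v)) = 0%R.
  apply: (@expo_trivial_word v) => //.
    rewrite /valid_word all_cat; apply/andP; split.
      exact: valid_word_section.
    by rewrite all_nseq /= leqnn orbT.
  by rewrite word_eval_cat ev0 word_eval_nseq /letter_eval /= expVgn mulgV.
rewrite expo_cat expo_nseq_inv; move: e0 e1; rewrite triv1 sw /=; lia.
Qed.

Theorem mainTheorem5 (v : seq bool) :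
  ~ exists H : set tree_aut, regular_branch_on (Kgroup v) H.
Proof.
move=> [H [[subH sHK _ HxH] finH]].
have [k k_gt0 Hk] := finite_index_power subH finH
  (fun k => Kgroup_gen_power k (leqnn (size v))).
have H1 : H 1%g by case: subH => /set_mem.
have /no_power_section k0 : Kgroup v (tree_pair (kgen v (size v) ^+ k) 1)%g.
  by apply: sHK; apply: HxH; exists (kgen v (size v) ^+ k, 1)%g.
by rewrite k0 in k_gt0.
Qed.
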